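(* The indices $\underline{\mathrm C}$ and $\mathrm C$ do not enjoy the $\sigma$-union property. That is, for each of $\mathrm C^+=\mathrm C$ and $\mathrm C^+=\underline{\mathrm C}$, it is not true that for every compact metric space $(X,d)$, every continuous map $\varphi:X\to X$ and every sequence $(Y_m)_{m\in\mathbb N}$ of subsets of $X$ one has $\mathrm C^+\big(\varphi,\bigcup_{m\in\mathbb N}Y_m\big)=\sup_{m\in\mathbb N}\mathrm C^+(\varphi,Y_m)$.
   Context: For a compact metric space $(X,d)$ and a continuous $\varphi:X\to X$: for $n\ge1$, $d_n^\varphi(x,y)=\max_{0\le k\le n-1}d(\varphi^k(x),\varphi^k(y))$. For $Y\subset X$ (not necessarily invariant), $G_n(Y,\varepsilon)$ is the minimal number of open $d_n^\varphi$-balls of radius $\varepsilon$ (centered at points of $X$) covering $Y$. Complexity index: $\mathrm C(\varphi,Y)=\lim_{\varepsilon\to0}\inf\{\sigma\ge0:\lim_{n\to\infty}n^{-\sigma}G_n(Y,\varepsilon)=0\}$. Lower complexity index: $\underline{\mathrm C}(\varphi,Y)=\lim_{\varepsilon\to0}\sup\{\sigma\ge0:\lim_{n\to\infty}n^{-\sigma}G_n(Y,\varepsilon)=+\infty\}$ (with $\sup\emptyset=0$). *)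

(* Defs.v *)
From HB Require Import structures.
From mathcomp Require Import all_boot all_order all_algebra.
From mathcomp Require Import all_classical all_reals all_analysis.

Set Implicit Arguments.
Unset Strict Implicit.
Unset Printing Implicit Defensive.

Import Order.TTheory GRing.Theory Num.Theory.
Import numFieldNormedType.Exports.

Local Open Scope classical_set_scope.
Local Open Scope ring_scope.

Section ComplexityIndices.
Context {R : realType} {X : metricType R}.
Implicit Types (phi : X -> X) (Y : set X) (n : nat) (eps sigma : R).

Definition dyn_dist phi n (x y : X) : R :=
  \big[Num.max/0]_(k < n) mdist (iter k phi x) (iter k phi y).

Definition dyn_ball phi n (x : X) eps : set X :=
  [set y | dyn_dist phi n x y < eps].

(* The list c enumerates the centers. The value is a natural number, attained
   as a minimum, whenever a finite cover exists (in particular for X compact,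
   phi continuous, eps > 0); otherwise it is +oo. *)
Definition cover_number phi Y n eps : \bar R :=
  ereal_inf [set (size c)%:R%:E | c in
    [set c : seq X | Y `<=` \bigcup_(x in [set` c]) dyn_ball phi n x eps]].

Definition scaled_cover_number phi Y eps sigma n : \bar R :=
  ((n%:R `^ (- sigma))%:E * cover_number phi Y n eps)%E.

Definition upper_exponents phi Y eps : set R :=
  [set sigma | 0 <= sigma /\
    scaled_cover_number phi Y eps sigma n @[n --> \oo] --> 0%E].

Definition lower_exponents phi Y eps : set R :=
  [set sigma | 0 <= sigma /\
    scaled_cover_number phi Y eps sigma n @[n --> \oo] --> +oo%E].

(* The infimum of the empty set is +oo. *)
Definition complexity_index phi Y : \bar R :=
  lim (ereal_inf (EFin @` upper_exponents phi Y eps) @[eps --> 0^'+]).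

(* In \bar R the supremum of the empty set is -oo; adjoining 0 implements the
   convention that it is 0, and changes nothing for a nonempty set of
   exponents, all of them being nonnegative. *)
Definition lower_complexity_index phi Y : \bar R :=
  lim (ereal_sup (0%E |` (EFin @` lower_exponents phi Y eps)) @[eps --> 0^'+]).

End ComplexityIndices.

Definition sigma_union_property (R : realType)
    (C : forall X : metricType R, (X -> X) -> set X -> \bar R) : Prop :=
  forall (X : metricType R) (phi : X -> X) (Y : nat -> set X),
    compact [set: X] -> continuous phi ->
    C X phi (\bigcup_m Y m) = ereal_sup (range (fun m => C X phi (Y m))).

(* Main.v *)
(** In the system below the [k]-th point reaches, after exactly [k] steps, a
    fixed point at distance 1 from all other points, so the first [n] points
    are pairwise 1-separated for the [n]-th dynamical distance and both indices
    of a set containing all of them are at least any [sigma < 1]. That set is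
    countable, and a single point always has index 0. *)

Require Import Defs.
From HB Require Import structures.
From mathcomp Require Import all_boot all_order all_algebra.
From mathcomp Require Import all_classical all_reals all_analysis.

Set Implicit Arguments.
Unset Strict Implicit.
Unset Printing Implicit Defensive.

Import Order.TTheory GRing.Theory Num.Theory.
Import numFieldNormedType.Exports.

Local Open Scope classical_set_scope.
Local Open Scope ring_scope.

(** * Asymptotics of powers of [n] *)

Lemma natr_powR_cvgy (R : realType) (s : R) : 0 < s ->
  (n%:R `^ s : R) @[n --> \oo] --> +oo.
Proof.
move=> s0; apply/cvgryPge => A.
near=> n.
have [A0|A0] := leP A 0; first by rewrite (le_trans A0)// powR_ge0.
have -> : A = (A `^ s^-1) `^ s.
  by rewrite -powRrM mulVf ?gt_eqF// powRr1// ltW.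
apply: ge0_ler_powR; rewrite ?nnegrE ?powR_ge0 ?ler0n ?(ltW s0)//.
by near: n; exact: nbhs_infty_ger.
Unshelve. all: by end_near. Qed.

Lemma natr_powRN_cvg0 (R : realType) (s : R) : 0 < s ->
  (n%:R `^ (- s) : R) @[n --> \oo] --> 0.
Proof.
move=> s0; under eq_fun do rewrite powRN.
apply/gtr0_cvgV0; last exact: natr_powR_cvgy.
near=> n; apply: powR_gt0; rewrite ltr0n.
by near: n; exact: nbhs_infty_gt.
Unshelve. all: by end_near. Qed.

(** * Monotonicity in the radius and comparison of the two indices *)

Section indices.
Context {R : realType} {X : metricType R}.
Variables (phi : X -> X) (Y : set X).
Implicit Types (eps s : R) (n : nat).

Lemma cover_number_ge0 n eps : (0 <= cover_number phi Y n eps)%E.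
Proof. by apply/ereal_infP => _ [c _ <-]; rewrite lee_fin. Qed.

Lemma scaled_cover_number_ge0 eps s n :
  (0 <= scaled_cover_number phi Y eps s n)%E.
Proof. by rewrite mule_ge0 ?cover_number_ge0// lee_fin powR_ge0. Qed.

Lemma le_cover_number n eps1 eps2 : eps1 <= eps2 ->
  (cover_number phi Y n eps2 <= cover_number phi Y n eps1)%E.
Proof.
move=> e12; apply: ereal_inf_le_tmp => _ [c cY <-]; exists c => // y /cY[x xc].
by rewrite /dyn_ball /= => xy; exists x => //=; exact: lt_le_trans e12.
Qed.

Lemma le_scaled_cover_number s n eps1 eps2 : eps1 <= eps2 ->
  (scaled_cover_number phi Y eps2 s n <= scaled_cover_number phi Y eps1 s n)%E.
Proof.
by move=> e12; rewrite lee_wpmul2l ?le_cover_number// lee_fin powR_ge0.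
Qed.

Lemma sub_upper_exponents eps1 eps2 : eps1 <= eps2 ->
  upper_exponents phi Y eps1 `<=` upper_exponents phi Y eps2.
Proof.
move=> e12 s [s0 sY]; split=> //.
apply: (squeeze_cvge _ (cvg_cst 0%E) sY); near=> n.
by rewrite scaled_cover_number_ge0 le_scaled_cover_number.
Unshelve. all: by end_near. Qed.

Lemma sub_lower_exponents eps1 eps2 : eps1 <= eps2 ->
  lower_exponents phi Y eps2 `<=` lower_exponents phi Y eps1.
Proof.
move=> e12 s [s0 /cvgeyPge sY]; split=> //; apply/cvgeyPge => A.
apply: filterS (sY A) => n /le_trans; apply.
exact: le_scaled_cover_number.
Qed.

(** Shrinking the radius shrinks the set of exponents, so its infimum is monotone and the [lim] in
    the definition is a genuine limit. *)
Lemma is_cvg_complexity_index :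
  cvg (ereal_inf (EFin @` upper_exponents phi Y eps) @[eps --> 0^'+]).
Proof.
apply: nonincreasing_at_right_is_cvge; near=> e => x y _ _ xy.
by apply: ereal_inf_le_tmp; apply: image_subset; exact: sub_upper_exponents.
Unshelve. all: by end_near. Qed.

Lemma is_cvg_lower_complexity_index :
  cvg (ereal_sup (0%E |` (EFin @` lower_exponents phi Y eps)) @[eps --> 0^'+]).
Proof.
apply: nonincreasing_at_right_is_cvge; near=> e => x y _ _ xy.
apply: le_ereal_sup; apply: setUS; apply: image_subset.
exact: sub_lower_exponents.
Unshelve. all: by end_near. Qed.

(** If [t < s], then [n ^ (- t)] dominates [n ^ (- s)], so the sequence scaled by [t] would tend
    both to [+oo] and to 0. *)
Lemma lower_exponents_le_upper eps s t :
  lower_exponents phi Y eps s -> upper_exponents phi Y eps t -> s <= t.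
Proof.
move=> [s0 sY] [t0 tY]; rewrite leNgt; apply/negP => ts.
have : scaled_cover_number phi Y eps t n @[n --> \oo] --> +oo%E.
  apply/cvgeyPge => A; near=> n.
  apply: (@le_trans _ _ (scaled_cover_number phi Y eps s n)).
    by near: n; exact: (cvgeyPge _).1.
  rewrite lee_wpmul2r ?cover_number_ge0// lee_fin ler_powR ?lerN2 ?(ltW ts)//.
  by rewrite ler1n; near: n; exact: nbhs_infty_gt.
by move=> /(cvg_unique (@ereal_hausdorff R)) /(_ tY).
Unshelve. all: by end_near. Qed.

(** Holds radius by radius, then in the limit. Thanks to it, the vanishing on singletons is computed
    only for the upper index and the lower bound on the union only for the lower one. *)
Lemma lower_complexity_index_le :
  (lower_complexity_index phi Y <= complexity_index phi Y)%E.
Proof.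
apply: (lee_cvg_to is_cvg_lower_complexity_index is_cvg_complexity_index).
near=> e; apply/ereal_infP => _ [t et <-].
apply/ereal_supP => _ [->|[s es <-]]; rewrite lee_fin; first by case: et.
exact: lower_exponents_le_upper et.
Unshelve. all: by end_near. Qed.

Lemma lower_complexity_index_ge0 : (0 <= lower_complexity_index phi Y)%E.
Proof.
apply: lime_ge; first exact: is_cvg_lower_complexity_index.
by near=> e; apply: ereal_sup_ubound; left.
Unshelve. all: by end_near. Qed.

Lemma lower_complexity_index_ge s :
  (\forall e \near 0^'+, lower_exponents phi Y e s) ->
  (s%:E <= lower_complexity_index phi Y)%E.
Proof.
move=> sY; apply: lime_ge; first exact: is_cvg_lower_complexity_index.
by apply: filterS sY => e es; apply: ereal_sup_ubound; right; exists s.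
Qed.

End indices.

(** * Singletons, and sets whose cover numbers grow at least linearly *)

Lemma cover_number_set1 (R : realType) (X : metricType R) (phi : X -> X)
    (y : X) n (eps : R) : 0 < eps ->
  (cover_number phi [set y] n eps <= 1)%E.
Proof.
move=> e0; apply: ge_ereal_inf; exists 1%E => //; exists [:: y] => //= _ ->.
exists y; first by rewrite /= inE.
by apply: bigmax_lt => // i _; rewrite mdistxx.
Qed.

(** One ball suffices, so every [s > 0] is an upper exponent and the infimum is 0 at each radius. *)
Lemma complexity_index_set1 (R : realType) (X : metricType R) (phi : X -> X)
    (y : X) : complexity_index phi [set y] = 0%E.
Proof.
apply: lim_near_cst => //; near=> e.
have e0 : 0 < e by near: e; exact: nbhs_right_gt.
apply/eqP; rewrite eq_le; apply/andP; split; last first.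
  by apply/ereal_infP => _ [s [s0 _] <-]; rewrite lee_fin.
apply/lee_addgt0Pr => s s0; rewrite add0e.
apply: ereal_inf_lbound; exists s => //; split; first exact: ltW.
have sn : (n%:R `^ (- s))%:E @[n --> \oo] --> (0 : R)%:E.
  by apply: cvg_EFin; [near=> n|exact: natr_powRN_cvg0].
apply: (squeeze_cvge _ (cvg_cst 0%E) sn).
near=> n; rewrite scaled_cover_number_ge0/= -[leRHS]mule1.
by rewrite lee_wpmul2l ?cover_number_set1// lee_fin powR_ge0.
Unshelve. all: by end_near. Qed.

Lemma lower_complexity_index_set1 (R : realType) (X : metricType R)
    (phi : X -> X) (y : X) : lower_complexity_index phi [set y] = 0%E.
Proof.
apply/eqP; rewrite eq_le lower_complexity_index_ge0 andbT.
by rewrite -(complexity_index_set1 phi y) lower_complexity_index_le.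
Qed.

(** The scaled cover number is at least [n ^ (1 - s)], whose exponent is positive. *)
Lemma lower_exponents_linear (R : realType) (X : metricType R) (phi : X -> X)
    (Y : set X) (eps s : R) : 0 <= s < 1 ->
  (forall n, (n%:R%:E <= cover_number phi Y n eps)%E) ->
  lower_exponents phi Y eps s.
Proof.
move=> /andP[s0 s1] nY; split=> //; apply/cvgeyPge => A; near=> n.
have n0 : (0 < n)%N by near: n; exact: nbhs_infty_gt.
apply: (@le_trans _ _ ((n%:R `^ (- s))%:E * n%:R%:E)%E); last first.
  by rewrite lee_wpmul2l// lee_fin powR_ge0.
rewrite -EFinM lee_fin -{2}[n%:R]powRr1 ?ler0n//.
rewrite -powRD; last by rewrite pnatr_eq0 -lt0n n0 implybT.
near: n; apply: (cvgryPge _).1; apply: natr_powR_cvgy.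
by rewrite addrC subr_gt0.
Unshelve. all: by end_near. Qed.

(* [None] is the limit of the points [Some k]. The parameter [R] only serves to
   attach the R-valued metric below to the type. *)
Definition countdown (R : realType) : Type := option nat.

HB.instance Definition _ (R : realType) :=
  Choice.copy (countdown R) (option nat).

(** * The compact countdown space *)

Section countdown.
Context {R : realType}.
Local Notation X := (countdown R).
Implicit Types x y z : X.

(** This is the distance to [None]. *)
Definition height x : R := if x is Some k then k.+1%:R^-1 else 0.

(** An ultrametric in which each [Some k] is isolated and [Some 0] lies at distance 1 from every
    other point. *)
Definition countdown_dist x y : R :=
  if x == y then 0 else Num.max (height x) (height y).

Lemma height_ge0 x : 0 <= height x.
Proof. by case: x => [k|]//=; rewrite invr_ge0. Qed.

Lemma countdown_distxx x : countdown_dist x x = 0.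
Proof. by rewrite /countdown_dist eqxx. Qed.

Lemma countdown_dist_positivity x y : countdown_dist x y = 0 -> x = y.
Proof.
rewrite /countdown_dist; case: eqP => // xy /eqP; rewrite eq_le ge_max.
case: x y xy => [k|] [l|] //= _ /andP[/andP[]];
  by rewrite ?invr_le0 ?lern0.
Qed.

Lemma countdown_dist_sym x y : countdown_dist x y = countdown_dist y x.
Proof. by rewrite /countdown_dist eq_sym maxC. Qed.

Lemma countdown_dist_triangle y x z :
  countdown_dist x z <= countdown_dist x y + countdown_dist y z.
Proof.
have [->|xy] := eqVneq x y; first by rewrite countdown_distxx add0r.
have [->|yz] := eqVneq y z; first by rewrite countdown_distxx addr0.
rewrite {2 3}/countdown_dist (negbTE xy) (negbTE yz).
rewrite /countdown_dist; case: ifP => _.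
  by rewrite addr_ge0// le_max height_ge0.
rewrite ge_max; apply/andP; split.
  by rewrite ler_wpDr ?le_max ?lexx ?height_ge0.
by rewrite ler_wpDl ?le_max ?lexx ?height_ge0 ?orbT.
Qed.

HB.instance Definition _ := @isMetric.Build R X countdown_dist
  countdown_distxx countdown_dist_positivity countdown_dist_sym
  countdown_dist_triangle.

Lemma mdist_countdown x y :
  x != y -> mdist x y = Num.max (height x) (height y).
Proof.
move=> xy; change (countdown_dist x y = Num.max (height x) (height y)).
by rewrite /countdown_dist (negbTE xy).
Qed.

(** An ultrafilter containing some [[set Some k]] converges to [Some k]; any other one contains all
    tails, which shrink to [None]. *)
Lemma countdown_compact : compact [set: X].
Proof.
rewrite compact_ultra => F UF _.
have [[k Fk]|nF] := pselect (exists k, F [set (Some k : X)]).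
  exists (Some k : X); split => // A /nbhs_singleton kA.
  by apply: filterS Fk => _ ->.
exists (None : X); split => //.
apply/metricType_numDomainType.cvgrPdist_lt => e e0.
have FN N : F [set x : X | if x is Some k then (N <= k)%N else true].
  elim: N => [|N IH]; first by apply: filterS filterT => -[].
  have [FN|FN] := in_ultra_setVsetC [set (Some N : X)] UF.
    by absurd: nF; exists N.
  apply: filterS (filterI IH FN) => -[k|]//= [Nk kN].
  by rewrite ltn_neqAle Nk andbT; apply/eqP => Ek; apply: kN; rewrite Ek.
have [N _ Ne] := near_infty_natSinv_lt (PosNum e0).
apply: filterS (FN N) => -[k Nk|_]; last by rewrite mdistxx.
rewrite mdist_countdown// gt_max/= e0/=.
by have := Ne k Nk.
Qed.

(** * Dynamics on the countdown space *)

Definition tick x : X := if x is Some k.+1 then Some k else x.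

Lemma height_tick x : height (tick x) <= 2 * height x.
Proof.
case: x => [[|k]|]/=; rewrite ?mulr0// ?invr1 ?mulr1 ?ler1n//.
rewrite ler_pdivlMr ?ltr0n// ler_pdivrMl ?ltr0n//.
by rewrite -natrM ler_nat muln2 -addnn addSn ltnS leq_addl.
Qed.

(** Points with distinct images are distinct, so both distances are maxima of heights, and [tick] at
    most doubles heights: it is 2-Lipschitz. *)
Lemma tick_continuous : continuous tick.
Proof.
move=> x; apply/(@metricType_numDomainType.cvgrPdist_lt _ _ _ (nbhs x)) => e e0.
have e20 : 0 < e / 2 by rewrite divr_gt0.
have : \forall y \near x, mdist x y < e / 2.
  by apply/metricType_numDomainType.nbhs_mdistP; exists (e / 2).
apply: filterS => y xy.
have [-> |nxy] := eqVneq (tick x) (tick y); first by rewrite mdistxx.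
have {}xy : Num.max (height x) (height y) < e / 2.
  move: xy; rewrite mdist_countdown//.
  by apply: contraNneq nxy => ->.
rewrite mdist_countdown//.
move: xy; rewrite !gt_max !ltr_pdivlMr// ![_ * 2]mulrC => /andP[xe ye].
by rewrite !(le_lt_trans (height_tick _)).
Qed.

Lemma iter_tick_Some n k : iter n tick (Some k) = Some (k - n)%N :> X.
Proof.
by elim: n => [|n IH]; rewrite ?subn0// iterS IH subnS; case: (k - n)%N.
Qed.

(** At time [i], which is observed because [i < n], the first point has just reached [Some 0] and
    the second has not. *)
Lemma dyn_dist_countdown n i j : (i < n)%N -> (i < j)%N ->
  1 <= dyn_dist tick n (Some i : X) (Some j).
Proof.
move=> ilt ij; pose F (k : 'I_n) : R :=
  mdist (iter k tick (Some i : X)) (iter k tick (Some j)).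
apply: le_trans (le_bigmax 0 F (Ordinal ilt)).
rewrite /F /= !iter_tick_Some mdist_countdown.
  by rewrite subnn le_max/= invr1 lexx.
by apply/eqP => -[] /eqP; rewrite subnn ltn_eqF// subn_gt0.
Qed.

(** A ball of such a radius contains at most one of the first [n] points, so choosing a center for
    each of them injects ['I_n] into [c]. *)
Lemma countdown_cover_number n (eps : R) : eps <= 2^-1 ->
  (n%:R%:E <= cover_number tick (range (fun k => Some k : X)) n eps)%E.
Proof.
move=> e2; apply/ereal_infP => _ [c cY <-]; rewrite lee_fin ler_nat.
have {}cY (i : 'I_n) : exists2 x : X, x \in c &
    dyn_dist tick n x (Some (i : nat)) < eps.
  by have [|x xc xi] := cY (Some (i : nat)); [exists (i : nat)|exists x].
have [f fc fi] : exists2 f : 'I_n -> X, (forall i, f i \in c) &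
    forall i, dyn_dist tick n (f i) (Some (i : nat)) < eps.
  by exists (fun i => s2val (cid2 (cY i))) => i; case: cid2.
have sep (i j : 'I_n) : (i < j)%N -> f i <> f j.
  move=> ij fij; have := dyn_dist_countdown (ltn_ord i) ij.
  (* A common center would put the two orbits within [eps + eps <= 1] of each other, strictly, at
     every time [k < n]. *)
  apply/negP; rewrite -ltNge; apply: bigmax_lt => // k _.
  have lek (x y : X) : mdist (iter k tick x) (iter k tick y)
      <= dyn_dist tick n x y.
    exact: (le_bigmax 0
      (fun k : 'I_n => mdist (iter k tick x) (iter k tick y)) k).
  apply: le_lt_trans (metric_triangle _ (iter k tick (f i)) _) _.
  rewrite (splitr 1) mul1r metric_sym {2}fij.
  by apply: ltrD; apply: (le_lt_trans (lek _ _)); apply: lt_le_trans e2.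
have finj : injective f.
  by move=> i j fij; apply: val_inj; case: (ltngtP i j) => // /sep; case.
rewrite -[n]size_enum_ord -(size_map f); apply: uniq_leq_size.
  by rewrite map_inj_uniq ?enum_uniq.
by move=> _ /mapP[i _ ->].
Qed.

(** The exponent [2^-1] is an arbitrary choice in []0, 1[], unrelated to the bound [2^-1] on the
    radius. *)
Lemma countdown_lower_complexity_index :
  (2^-1%:E <= lower_complexity_index tick (range (fun k => Some k : X)))%E.
Proof.
apply: lower_complexity_index_ge; near=> e.
apply: lower_exponents_linear; first by rewrite invr_ge0 ler0n invf_lt1 ?ltr1n.
move=> n; apply: countdown_cover_number.
by near: e; apply: nbhs_right_le; rewrite invr_gt0.
Unshelve. all: by end_near. Qed.

End countdown.

(** Stated for any [C] that vanishes on singletons and dominates the lower index, so as to treat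
    both indices at once. *)
Lemma not_sigma_union_property (R : realType)
    (C : forall X : metricType R, (X -> X) -> set X -> \bar R) :
  (forall (X : metricType R) phi (y : X), C X phi [set y] = 0%E) ->
  (forall (X : metricType R) phi (Y : set X),
    (lower_complexity_index phi Y <= C X phi Y)%E) ->
  ~ sigma_union_property C.
Proof.
move=> C1 leC CU; pose Y k := [set (Some k : countdown R)].
have := CU _ tick Y countdown_compact tick_continuous.
have -> : range (fun k => C _ tick (Y k)) = [set 0%E].
  apply/seteqP; split => [_ [k _ <-]|_ ->]; first exact: C1.
  by exists 0; rewrite ?C1.
rewrite ereal_sup1 => C0.
have YE : \bigcup_k Y k = range (fun k => Some k : countdown R).
  by apply/seteqP; split => [_ [k _ ->]|_ [k _ <-]]; exists k.
have := le_trans countdown_lower_complexity_index (leC _ tick (range _)).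
by rewrite -YE C0 lee_fin invr_le0 lern0.
Qed.

Theorem corollary2p1 (R : realType) :
  ~ sigma_union_property (@lower_complexity_index R) /\
  ~ sigma_union_property (@complexity_index R).
Proof.
split; apply: not_sigma_union_property.
- exact: lower_complexity_index_set1.
- by [].
- exact: complexity_index_set1.
- by move=> X phi Y; exact: lower_complexity_index_le.
Qed.
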